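(* Let $\mathbb{H}$ be a complex Hilbert space and let $A,B\in\mathbb{B}(\mathbb{H})$. Then $$\|(A,B)\|_e^2\le\sqrt{\omega\left(|A|^2+\mathrm{i}|B|^2\right)\omega\left(|A^*|^2+\mathrm{i}|B^*|^2\right)+\omega\left(|A|+\mathrm{i}|B|\right)\omega\left(|A^*|+\mathrm{i}|B^*|\right)\omega(BA^* )}.$$
   Context: $\mathbb{B}(\mathbb{H})$ is the algebra of bounded linear operators on $\mathbb{H}$, $|T|=(T^*T)^{1/2}$, $\mathrm{i}$ is the imaginary unit, and $\omega(T)=\sup_{\|x\|=1}|\langle Tx,x\rangle|$ is the numerical radius. The Euclidean operator norm of a pair is $\|(A,B)\|_e=\sup\{\|\lambda_1A+\lambda_2B\|:\lambda_1,\lambda_2\in\mathbb{C},\ |\lambda_1|^2+|\lambda_2|^2\le 1\}$, where $\|\cdot\|$ is the operator norm; equivalently (known), $\|(A,B)\|_e=\sup_{\|x\|=\|y\|=1}\left(|\langle Ax,y\rangle|^2+|\langle Bx,y\rangle|^2\right)^{1/2}$. *)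

(* Defs.v *)
From HB Require Import structures.
From mathcomp Require Import all_boot all_order all_algebra.
From mathcomp Require Import complex.
From mathcomp Require Import all_classical all_reals all_analysis.

Set Implicit Arguments.
Unset Strict Implicit.
Unset Printing Implicit Defensive.

Import Order.TTheory GRing.Theory Num.Theory.
Import numFieldNormedType.Exports.

Local Open Scope classical_set_scope.
Local Open Scope ring_scope.

(* The inner product is linear in its first argument and conjugate-linear in
   the second one. *)
HB.mixin Record CompleteNormedModule_isHilbert (R : realType) H
    & CompleteNormedModule R[i] H := {
  inner : {dot H for (@Num.conj R[i])} ;
  sqr_norm_inner : forall x : H, `|x| ^+ 2 = inner x x
}.

#[short(type="hilbertType")]
HB.structure Definition Hilbert (R : realType) :=
  {H of CompleteNormedModule R[i] H & CompleteNormedModule_isHilbert R H}.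

Section Operators.
Context {R : realType} {H : hilbertType R}.
Implicit Types (x y : H) (S T A B : H -> H).

Local Notation "''[' x , y ]" := (inner x y) : ring_scope.

(* Norms and moduli of the library are elements of [R[i]]; this is the same
   number in [R]. *)
Definition rnorm (V : normedZmodType R[i]) (v : V) : R := complex.Re `|v|.

Definition bounded_operator T : Prop :=
  linear T /\ exists M : R, forall x, rnorm (T x) <= M * rnorm x.

Definition positive_operator T : Prop :=
  bounded_operator T /\ forall x, 0 <= '[T x, x].

(* [adjoint T] and [sqrt_operator T] are the unique elements of the sets below
   when [T] is bounded, respectively positive (and [0] if there are none). *)
Definition adjoint T : H -> H :=
  xget (fun=> 0) [set S | bounded_operator S /\
                          forall x y, '[T x, y] = '[x, S y]].

Definition sqrt_operator T : H -> H :=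
  xget (fun=> 0) [set S | positive_operator S /\ S \o S = T].

Definition abs_operator T : H -> H := sqrt_operator (adjoint T \o T).

Definition opnorm T : R := sup [set rnorm (T x) | x in [set x | rnorm x <= 1]].

(* On the zero space the supremum is over the empty set, and is [0]. *)
Definition numerical_radius T : R :=
  sup [set rnorm '[T x, x] | x in [set x | rnorm x = 1]].

Definition euclidean_opnorm A B : R :=
  sup [set opnorm (l.1 \*: A \+ l.2 \*: B) |
       l in [set l : R[i] * R[i] | rnorm l.1 ^+ 2 + rnorm l.2 ^+ 2 <= 1]].

End Operators.

(* Main.v *)
Require Import Defs.
From mathcomp Require Import all_boot all_order all_algebra.
From mathcomp Require Import complex.
From mathcomp Require Import all_classical all_reals all_analysis.
From mathcomp Require Import ring lra.

Import Order.TTheory GRing.Theory Num.Theory.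
Import numFieldNormedType.Exports.

Local Open Scope ring_scope.

(** Write [A'] and [B'] for the adjoints.  Fix [x] and [y], and put [u = A' y],
    [v = B' y], [a = |<Ax, y>| = |<x, u>|] and [b = |<Bx, y>| = |<x, v>|].
    Then [a^2 + b^2 = <x, z>] for the vector [z = <x, u> u + <x, v> v], and
    Cauchy-Schwarz applied to [<x, z>] gives, after expanding [|z|^2],

      (a^2 + b^2)^2 <= |x|^2 (a^2 |u|^2 + b^2 |v|^2 + 2 a b |<u, v>|)

    ([sum_sqr_inner_le]).  Each piece is bounded by numerical radii.  For
    positive [P] and [S] the number [<(P + iS)x, x>] has real part [<Px, x>]
    and imaginary part [<Sx, x>], so [w(P + iS)] controls the Euclidean norm of
    the pair [(<Px, x>, <Sx, x>)] ([numerical_radius_pair]).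
    - As [a <= |Ax| |y|] and [b <= |Bx| |y|], the first two terms are at most
      [|y|^2] times the scalar product of the pairs [(|Ax|^2, |Bx|^2)] and
      [(|u|^2, |v|^2)], where [|Ax|^2 = <|A|^2 x, x>] and
      [|u|^2 = <|A'|^2 y, y>].
    - The mixed Schwarz inequality [a^2 <= <|A|x, x> <|A'|y, y>] and its
      analogue for [b] bound [2 a b] by [w(|A| + i|B|) w(|A'| + i|B'|)], with
      the arithmetic-geometric mean inequality used once for [x] and once for
      [y].
    - [<u, v> = <B A' y, y>] is bounded by [w(B A')].
    The Euclidean norm follows by taking [y] to be the value at [x] of a
    combination of [A] and [B].

    The moduli require the theory of square roots.  Adjoints come from the
    Riesz representation theorem, itself a consequence of the projection
    theorem.  A positive [T], scaled so that [0 <= T <= 1], has the square root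
    [1 - Y], where [Y] is the limit of [Y_(n+1) = (K + Y_n^2) / 2], [Y_0 = 0],
    [K = 1 - T].  The approximants are polynomials in [T], which gives
    uniqueness of the positive square root, and the intertwining relation
    [A |A| = |A'| A] ([abs_operator_intertwine]) from [A (A' A) = (A A') A].
    This relation makes the mixed Schwarz inequality an instance of
    Cauchy-Schwarz for the form of [|A'|] when [x] lies in the range of [|A|];
    the general case follows by projecting [x] on the closure of that range,
    whose orthogonal complement is killed by [A] and by [|A|]. *)

(** * Real-valued norms *)
Section Scalars.
Context {R : realType}.
Implicit Types (z w : R[i]).

Lemma rnorm_complex (V : normedZmodType R[i]) (v : V) : `|v| = (rnorm v)%:C%C.
Proof. by rewrite /rnorm RRe_real // ger0_real. Qed.

Lemma sqr_rnormc z : rnorm z ^+ 2 = complex.Re z ^+ 2 + complex.Im z ^+ 2.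
Proof.
by apply: complexI; rewrite rmorphXn /= -rnorm_complex add_Re2_Im2.
Qed.

Lemma rnormcM z w : rnorm (z * w) = rnorm z * rnorm w.
Proof. by apply: complexI; rewrite rmorphM /= -!rnorm_complex normrM. Qed.

Lemma rnormcJ z : rnorm z^*%C = rnorm z.
Proof. by rewrite /rnorm normcJ. Qed.

Lemma rnorm_real (a : R) : rnorm (a%:C%C : R[i]) = `|a|.
Proof. by rewrite /rnorm normc_def /= expr0n /= addr0 sqrtr_sqr. Qed.

Lemma ler_Re_rnorm z : complex.Re z <= rnorm z.
Proof.
apply: le_trans (ler_norm _) _; rewrite -lecR -rnorm_complex; exact: normc_ge_Re.
Qed.

Lemma ReD z w : complex.Re (z + w) = complex.Re z + complex.Re w.
Proof. by case: z w => ? ? []. Qed.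

Lemma ReM z w : complex.Re (z * w) =
  complex.Re z * complex.Re w - complex.Im z * complex.Im w.
Proof. by case: z w => ? ? []. Qed.

Lemma ReN z : complex.Re (- z) = - complex.Re z.
Proof. by case: z. Qed.

Lemma Re_realM (a : R) z : complex.Re (a%:C%C * z) = a * complex.Re z.
Proof. by rewrite ReM /= mul0r subr0. Qed.

Lemma ReJ z : complex.Re z^*%C = complex.Re z.
Proof. by case: z. Qed.

(** A rotation turns a bound on real parts into a bound on moduli. *)
Lemma phase z : exists2 u : R[i], rnorm u = 1 & u * z = (rnorm z)%:C%C.
Proof.
have [->|z0] := eqVneq z 0.
  exists 1; first by rewrite (rnorm_real 1) normr1.
  by rewrite mulr0 (rnorm_real 0) normr0.
exists (`|z| / z); last by rewrite divfK // rnorm_complex.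
apply: complexI.
by rewrite -rnorm_complex normrM normfV normr_id mulfV // normr_eq0.
Qed.

End Scalars.

Section RealNorm.
Context {R : realType} {V : normedZmodType R[i]}.
Implicit Types (x y : V).

Lemma rnorm_ge0 x : 0 <= rnorm x.
Proof. by rewrite -ler0c -rnorm_complex. Qed.

Lemma rnorm0 : rnorm (0 : V) = 0.
Proof. by rewrite /rnorm normr0. Qed.

Lemma rnorm_eq0 x : rnorm x = 0 -> x = 0.
Proof.
by move=> x0; apply/eqP; rewrite -normr_eq0 rnorm_complex x0.
Qed.

Lemma rnormN x : rnorm (- x) = rnorm x.
Proof. by rewrite /rnorm normrN. Qed.

Lemma rdistC x y : rnorm (x - y) = rnorm (y - x).
Proof. by rewrite /rnorm distrC. Qed.

Lemma ler_rnormD x y : rnorm (x + y) <= rnorm x + rnorm y.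
Proof. by rewrite -lecR rmorphD /= -!rnorm_complex ler_normD. Qed.

Lemma ler_rdistD z x y : rnorm (x - y) <= rnorm (x - z) + rnorm (z - y).
Proof. by rewrite -{1}(subrK z x) -addrA ler_rnormD. Qed.

End RealNorm.

Lemma rnormZ {R : realType} {V : normedModType R[i]} (a : R[i]) (x : V) :
  rnorm (a *: x) = rnorm a * rnorm x.
Proof. by apply: complexI; rewrite rmorphM /= -!rnorm_complex normrZ. Qed.

(** * Limits with an explicit rate *)
Section Rates.
Context {R : realType}.

(** Every limit below is approached at rate [C / (n + 1)]; an inequality then
    passes to the limit by this archimedean argument, with [C] collecting all
    the constants. *)
Lemma ler0_of_rate (a C : R) : (forall n, a <= C / n.+1%:R) -> a <= 0.
Proof.
move=> aC; rewrite leNgt; apply/negP => a0.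
have C0 : 0 <= C by have := aC 0%N; rewrite divr1; apply/le_trans/ltW.
have := archi_boundP (divr_ge0 C0 (ltW a0)).
set n := Num.bound _ => /ltW; rewrite ler_pdivrMr // => Cn.
have := aC n; rewrite ler_pdivlMr // leNgt => /negP; apply.
by apply: le_lt_trans Cn _; rewrite mulrC ltr_pM2l // ltr_nat.
Qed.

(** The limit inherits the rate, so that later estimates need no further
    reference to filters. *)
Lemma rate_complete {V : completeNormedModType R[i]} (u : nat -> V) (C : R) :
  (forall n m, (n <= m)%N -> rnorm (u m - u n) <= C / n.+1%:R) ->
  exists l, forall n, rnorm (u n - l) <= C / n.+1%:R.
Proof.
move=> uC.
have C0 : 0 <= C by have := uC 0%N 0%N (leqnn _); rewrite divr1; apply/le_trans/rnorm_ge0.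
have cu : cvg (u @ \oo)%classic.
  apply/cauchy_cvgP/cauchy_exP => e e0.
  have er : e = (complex.Re e)%:C%C by rewrite RRe_real // gtr0_real.
  move: e0; rewrite er ltcR; set d := complex.Re e => d0.
  have := archi_boundP (divr_ge0 C0 (ltW d0)).
  set N := Num.bound _; rewrite ltr_pdivrMr // => CN.
  exists (u N), N => // m /= Nm.
  rewrite -ball_normE /= rnorm_complex ltcR rdistC.
  apply: le_lt_trans (uC _ _ Nm) _.
  rewrite ltr_pdivrMr //; apply: lt_le_trans CN _.
  by rewrite mulrC ler_pM2l // ler_nat.
exists (lim (u @ \oo)%classic) => n.
apply/ler_addgt0Pr => e e0.
have /cvgr_dist_lt /(_ e%:C%C) := cu.
rewrite ltcR => /(_ e0) [N _ uN].
have := uN (maxn n N) (leq_maxr _ _); rewrite /= rnorm_complex ltcR => /ltW l1.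
apply: le_trans (ler_rdistD (u (maxn n N)) _ _) _.
by rewrite rdistC lerD // 1?rdistC // rdistC uC // leq_maxl.
Qed.

End Rates.

Local Notation "''[' x , y ]" := (inner x y) : ring_scope.

(** * Inner product, linear maps and positive forms *)

(** A quadratic polynomial in [t] without sign change has a nonpositive
    discriminant; both Cauchy-Schwarz for positive forms and the orthogonality
    of the error of a best approximation are obtained in this way. *)
Lemma ler_sqr_discr {R : realFieldType} (a b c : R) :
  0 <= b -> (forall t, 0 <= a + 2 * t * c + t ^+ 2 * b) -> c ^+ 2 <= a * b.
Proof.
move=> b0 abc; have [bE|bN0] := eqVneq b 0.
  have [->|cN0] := eqVneq c 0; first by rewrite bE mulr0 expr0n.
  have := abc (- (a + 1) / (2 * c)); rewrite bE mulr0 addr0.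
  have -> : 2 * (- (a + 1) / (2 * c)) * c = - (a + 1) by field.
  by move=> h; exfalso; lra.
have {b0 bN0}b0 : 0 < b by rewrite lt0r bN0.
have := abc (- c / b).
have -> : a + 2 * (- c / b) * c + (- c / b) ^+ 2 * b = (a * b - c ^+ 2) / b.
  by field; rewrite gt_eqF.
by rewrite pmulr_lge0 ?invr_gt0 // subr_ge0.
Qed.

Section InnerProduct.
Context {R : realType} {H : hilbertType R}.
Implicit Types (x y z : H) (a : R[i]) (t : R).

Lemma innerDl x y z : '[x + y, z] = '[x, z] + '[y, z].
Proof. exact: linearDl. Qed.
Lemma innerDr x y z : '[x, y + z] = '[x, y] + '[x, z].
Proof. exact: linearDr. Qed.
Lemma innerNl x z : '[- x, z] = - '[x, z].
Proof. exact: linearNl. Qed.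
Lemma innerNr x y : '[x, - y] = - '[x, y].
Proof. exact: linearNr. Qed.
Lemma innerBl x y z : '[x - y, z] = '[x, z] - '[y, z].
Proof. exact: linearBl. Qed.
Lemma innerBr x y z : '[x, y - z] = '[x, y] - '[x, z].
Proof. exact: linearBr. Qed.
Lemma inner0l x : '[0, x] = 0.
Proof. exact: linear0l. Qed.
Lemma inner0r x : '[x, 0] = 0.
Proof. exact: linear0r. Qed.
Lemma innerZl a x y : '[a *: x, y] = a * '[x, y].
Proof. exact: linearZl_LR. Qed.
Lemma innerZr a x y : '[x, a *: y] = a^*%C * '[x, y].
Proof. exact: linearZr_LR. Qed.
Lemma innerC x y : '[x, y] = '[y, x]^*%C.
Proof. by rewrite hermC expr0 mul1r. Qed.

Definition reinner x y : R := complex.Re '[x, y].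

Lemma reinnerDl x y z : reinner (x + y) z = reinner x z + reinner y z.
Proof. by rewrite /reinner innerDl ReD. Qed.
Lemma reinnerDr x y z : reinner x (y + z) = reinner x y + reinner x z.
Proof. by rewrite /reinner innerDr ReD. Qed.
Lemma reinnerNl x y : reinner (- x) y = - reinner x y.
Proof. by rewrite /reinner innerNl ReN. Qed.
Lemma reinnerNr x y : reinner x (- y) = - reinner x y.
Proof. by rewrite /reinner innerNr ReN. Qed.
Lemma reinnerZl t x y : reinner (t%:C%C *: x) y = t * reinner x y.
Proof. by rewrite /reinner innerZl Re_realM. Qed.
Lemma reinnerZr t x y : reinner x (t%:C%C *: y) = t * reinner x y.
Proof. by rewrite /reinner innerZr conjc_real Re_realM. Qed.
Lemma reinnerC x y : reinner x y = reinner y x.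
Proof. by rewrite /reinner innerC ReJ. Qed.
Definition reinnerE := (reinnerDl, reinnerDr, reinnerNl, reinnerNr, reinnerZl, reinnerZr).

Lemma reinnerxx x : reinner x x = rnorm x ^+ 2.
Proof. by rewrite /reinner -sqr_norm_inner rnorm_complex -rmorphXn. Qed.

Lemma innerxx x : '[x, x] = (rnorm x ^+ 2)%:C%C.
Proof. by rewrite rmorphXn /= -rnorm_complex sqr_norm_inner. Qed.

Lemma parallelogram x y :
  rnorm (x + y) ^+ 2 + rnorm (x - y) ^+ 2 = 2 * (rnorm x ^+ 2 + rnorm y ^+ 2).
Proof. by rewrite -!reinnerxx !reinnerE (reinnerC y x); ring. Qed.

End InnerProduct.

Section LinearMaps.
Context {R : realType} {H : hilbertType R}.
Implicit Types (x y z : H) (a : R[i]) (S T : H -> H).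

Lemma op_lin T : bounded_operator T -> linear T.
Proof. by case. Qed.

Section Linear.
Variables (T : H -> H) (linT : linear T).

Lemma opD x y : T (x + y) = T x + T y.
Proof. by have := linT 1 x y; rewrite !scale1r. Qed.

Lemma op0 : T 0 = 0.
Proof. by apply: (addrI (T 0)); rewrite -opD !addr0. Qed.

Lemma opZ a x : T (a *: x) = a *: T x.
Proof. by have := linT a x 0; rewrite !addr0 op0 addr0. Qed.

Lemma opN x : T (- x) = - T x.
Proof. by rewrite -scaleN1r opZ scaleN1r. Qed.

Lemma opB x y : T (x - y) = T x - T y.
Proof. by rewrite opD opN. Qed.

End Linear.

Lemma op_bound T : bounded_operator T ->
  exists2 M : R, 0 < M & forall x, rnorm (T x) <= M * rnorm x.
Proof.
case=> _ [M TM]; exists (`|M| + 1); first by rewrite ltr_wpDl.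
move=> x; apply: le_trans (TM x) _; apply: ler_wpM2r (rnorm_ge0 _) _ _ _.
by apply: le_trans (ler_norm _) _; rewrite lerDl.
Qed.

Lemma bounded_comp S T :
  bounded_operator S -> bounded_operator T -> bounded_operator (S \o T).
Proof.
move=> bS bT; have [M M0 SM] := op_bound _ bS; have [N N0 TN] := op_bound _ bT.
split=> [a x y|].
  by rewrite /= (opD _ (op_lin _ bT)) (opZ _ (op_lin _ bT)) (op_lin _ bS).
exists (M * N) => x /=; apply: le_trans (SM _) _.
by rewrite -mulrA ler_pM2l.
Qed.

Lemma bounded_add S T :
  bounded_operator S -> bounded_operator T -> bounded_operator (S \+ T).
Proof.
move=> [linS [M SM]] [linT [N TN]]; split=> [a x y|].
  by rewrite /= linS linT scalerDr addrACA.
by exists (M + N) => x; apply: le_trans (ler_rnormD _ _) _; rewrite mulrDl lerD.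
Qed.

Lemma bounded_scale a T : bounded_operator T -> bounded_operator (a \*: T).
Proof.
move=> [linT [M TM]]; split=> [b x y|].
  by rewrite /= linT scalerDr !scalerA mulrC.
exists (rnorm a * M) => x.
by rewrite /= rnormZ -mulrA ler_wpM2l // rnorm_ge0.
Qed.

Lemma bounded_id : bounded_operator (@idfun H).
Proof. by split=> [a x y //|]; exists 1 => x; rewrite mul1r. Qed.

End LinearMaps.

Section PositiveForms.
Context {R : realType} {H : hilbertType R}.
Variables (T : H -> H) (linT : linear T) (posT : forall x, 0 <= '[T x, x]).
Implicit Types (x y : H).

(** Over the complex numbers positivity implies symmetry: the values of the
    quadratic form at [x + y] and at [x + i y] are real, which gives the
    imaginary and the real part of the identity. *)
Lemma pos_symmetric x y : '[T x, y] = '[x, T y].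
Proof.
have Im0 z : complex.Im '[T z, z] = 0 by apply: ger0_Im.
have := Im0 (x + y); have := Im0 (x + 'i%C *: y); have := Im0 x; have := Im0 y.
rewrite (innerC x (T y)) !(opD _ linT) !(opZ _ linT) !innerDl !innerDr !innerZl !innerZr.
case: '[T x, x] => x1 x2; case: '[T y, y] => y1 y2.
case: '[T x, y] => a1 a2; case: '[T y, x] => b1 b2 /=; simpc => /=.
move=> y20 x20 h1 h2; congr (_ +i* _)%C; lra.
Qed.

Lemma pos_reinner_sym x y : reinner (T x) y = reinner x (T y).
Proof. by rewrite /reinner pos_symmetric. Qed.

Lemma pos_reinner_ge0 x : 0 <= reinner (T x) x.
Proof. by have := posT x; rewrite lecE => /andP[]. Qed.

Lemma pos_innerE x : '[T x, x] = (reinner (T x) x)%:C%C.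
Proof. by rewrite /reinner RRe_real // ger0_real. Qed.

Lemma pos_CauchySchwarz x y :
  rnorm '[T x, y] ^+ 2 <= reinner (T x) x * reinner (T y) y.
Proof.
have real_CS z : reinner (T z) y ^+ 2 <= reinner (T z) z * reinner (T y) y.
  apply: ler_sqr_discr (pos_reinner_ge0 _) _ => t.
  have := pos_reinner_ge0 (z + t%:C%C *: y).
  rewrite (opD _ linT) (opZ _ linT) !reinnerE (pos_reinner_sym y z) (reinnerC y).
  by congr (_ <= _); ring.
have [u u1 uE] := phase '[T x, y].
have := real_CS (u *: x).
rewrite {1 2}/reinner (opZ _ linT) !innerZl innerZr uE /= mulrA -sqr_normc.
by rewrite rnorm_complex u1 expr1n mul1r.
Qed.

(** Cauchy-Schwarz for the form of [T], applied to [x] and [T x]. *)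
Lemma pos_op0 x : reinner (T x) x = 0 -> T x = 0.
Proof.
move=> Tx0; apply: rnorm_eq0; apply/eqP; rewrite -sqrf_eq0 -sqrf_eq0; apply/eqP/le_anti.
rewrite sqr_ge0 andbT -{1}reinnerxx.
have := pos_CauchySchwarz x (T x); rewrite Tx0 mul0r.
by rewrite innerxx rnorm_real ger0_norm ?sqr_ge0 // reinnerxx.
Qed.

End PositiveForms.

Section CauchySchwarz.
Context {R : realType} {H : hilbertType R}.
Implicit Types (x y : H).

Lemma CauchySchwarz x y : rnorm '[x, y] <= rnorm x * rnorm y.
Proof.
rewrite -(ler_pXn2r (n := 2)) // ?nnegrE ?mulr_ge0 ?rnorm_ge0 //.
rewrite exprMn -!reinnerxx.
by apply: (@pos_CauchySchwarz _ _ idfun) => // z /=.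
Qed.

Lemma reinner_le x y : reinner x y <= rnorm x * rnorm y.
Proof. exact: le_trans (ler_Re_rnorm _) (CauchySchwarz _ _). Qed.

Lemma inner_ext x y : (forall z, '[z, x] = '[z, y]) -> x = y.
Proof.
move=> xy; apply/eqP; rewrite -subr_eq0; apply/eqP/rnorm_eq0/eqP.
by rewrite -sqrf_eq0 -reinnerxx /reinner innerBr xy subrr.
Qed.

End CauchySchwarz.

(** * Orthogonal projection, Riesz representation and adjoints *)
Section Projection.
Context {R : realType} {H : hilbertType R}.
Implicit Types (x y z : H).

(** The point [p] lies in the closure of [K], as witnessed by a sequence of [K]
    converging to [p] at a known rate.  The sequence nearly minimises the
    distance to [x]; it is Cauchy by the parallelogram identity, and its
    differences with [x] are nearly orthogonal to [K], since moving its members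
    along [K] cannot decrease the distance much. *)
Lemma orthogonal_projection (K : H -> Prop) x :
  K 0 -> (forall (a : R[i]) y z, K y -> K z -> K (a *: y + z)) ->
  exists2 p : H, forall z, K z -> '[x - p, z] = 0 &
    exists k : nat -> H, forall n, K (k n) /\ rnorm (k n - p) <= 2 / n.+1%:R.
Proof.
move=> K0 linK.
have KZ a z : K z -> K (a *: z) by move=> Kz; rewrite -[_ *: _]addr0; apply: linK.
have KD y z : K y -> K z -> K (y + z) by rewrite -{2}[y]scale1r; apply: linK.
pose E : set R := [set rnorm (x - k) ^+ 2 | k in [set k | K k]]%classic.
have hasE : has_inf E.
  by split; [exists (rnorm (x - 0) ^+ 2), 0 | exists 0 => _ [k _ <-]; exact: sqr_ge0].
have dE k : K k -> inf E <= rnorm (x - k) ^+ 2.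
  by move=> Kk; apply: (ge_inf hasE.2); exists k.
(* The excess over the infimum is squared so that distances, which enter
   through their squares, converge at rate [1 / (n + 1)]. *)
pose e n : R := n.+1%:R^-1.
have e0 n : 0 < e n by rewrite invr_gt0.
have near_min n : {k | K k /\ rnorm (x - k) ^+ 2 < inf E + e n ^+ 2}.
  apply: cid; have [_ [k Kk <-] kd] := inf_adherent (exprn_gt0 2 (e0 n)) hasE.
  by exists k.
pose k n := sval (near_min n).
have Kk n : K (k n) by have [] := svalP (near_min n).
have kd n : rnorm (x - k n) ^+ 2 < inf E + e n ^+ 2 by have [] := svalP (near_min n).
have [|p kp] := rate_complete k 2.
  move=> n m nm; rewrite -(ler_pXn2r (n := 2)) ?nnegrE ?rnorm_ge0 ?mulr_ge0 ?(ltW (e0 _)) //.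
  have mid : inf E <= rnorm (x - (2^-1)%:C%C *: (k n + k m)) ^+ 2.
    by apply/dE/KZ/KD.
  have em : e m ^+ 2 <= e n ^+ 2.
    by rewrite ler_pXn2r ?nnegrE ?(ltW (e0 _)) // lef_pV2 ?posrE // ler_nat.
  have := parallelogram (x - k n) (x - k m).
  have -> : x - k n + (x - k m) = 2%:R%:C%C *: (x - (2^-1)%:C%C *: (k n + k m)).
    rewrite scalerBr scalerA -rmorphM /= mulfV ?pnatr_eq0 // scale1r.
    by rewrite rmorph_nat scaler_nat mulr2n opprD addrACA.
  have -> : x - k n - (x - k m) = k m - k n by rewrite opprB addrC subrKA.
  rewrite rnormZ rnorm_real ger0_norm // !exprMn => par.
  have := kd n; have := kd m; rewrite -/(e n); lra.
exists p; last by exists k => n; split.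
have near_orth n z : K z -> reinner (x - k n) z <= e n * rnorm z.
  move=> Kz; apply: le_trans (ler_norm _) _.
  rewrite -(ler_pXn2r (n := 2)) ?nnegrE ?mulr_ge0 ?rnorm_ge0 ?(ltW (e0 _)) //.
  rewrite real_normK ?num_real // exprMn; apply: ler_sqr_discr (sqr_ge0 _) _ => t.
  have KB : K (k n - t%:C%C *: z) by rewrite -scaleNr addrC; apply: linK.
  have := dE _ KB; have := kd n; rewrite opprB addrCA addrC.
  move: (x - k n) => w; rewrite -[rnorm (w + _) ^+ 2]reinnerxx.
  by rewrite !reinnerE (reinnerC z) !reinnerxx; lra.
have orth z : K z -> reinner (x - p) z <= 0.
  move=> Kz; apply: (@ler0_of_rate _ _ (3 * rnorm z)) => n.
  rewrite -{1}[x](subrK (k n)) -addrA reinnerDl.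
  have := near_orth n _ Kz; have := reinner_le (k n - p) z.
  have := ler_wpM2r (rnorm_ge0 z) (kp n).
  rewrite -/(e n); lra.
move=> z Kz; apply: rnorm_eq0; apply/le_anti; rewrite rnorm_ge0 andbT.
have [u u1 uE] := phase '[x - p, z].
have := orth _ (KZ u^*%C _ Kz).
by rewrite /reinner innerZr conjcK uE.
Qed.

(** If [w] is orthogonal to the kernel of [f] and [f w <> 0], then
    [x - (f x / f w) w] lies in the kernel, so it is orthogonal to [w]; solving
    for [f x] shows that a multiple of [w] represents [f]. *)
Lemma Riesz_representation (f : H -> R[i]) (M : R) :
  scalar f -> (forall x, rnorm (f x) <= M * rnorm x) ->
  exists w, forall x, f x = '[x, w].
Proof.
move=> linf fM.
have [f0|/existsNP[z fz]] := pselect (forall x, f x = 0).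
  by exists 0 => x; rewrite inner0r f0.
have fD x y : f (x + y) = f x + f y by have := linf 1 x y; rewrite scale1r mul1r.
have f0 : f 0 = 0 by apply: (addrI (f 0)); rewrite -fD !addr0.
have fZ a x : f (a *: x) = a * f x by have := linf a x 0; rewrite !addr0 f0 addr0.
have fB x y : f (x - y) = f x - f y by rewrite fD -scaleN1r fZ mulN1r.
have [||p orth [k kP]] := orthogonal_projection (fun y => f y = 0) z.
- by [].
- by move=> a x y fx fy; rewrite linf fx fy mulr0 addr0.
have fp : f p = 0.
  apply: rnorm_eq0; apply/le_anti; rewrite rnorm_ge0 andbT.
  apply: (@ler0_of_rate _ _ (`|M| * 2)) => n.
  have [fk kp] := kP n.
  rewrite -rnormN -[- f p]add0r -fk -fB; apply: le_trans (fM _) _.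
  apply: le_trans (ler_wpM2r (rnorm_ge0 _) (ler_norm M)) _.
  by rewrite -mulrA; apply: ler_wpM2l.
pose w := z - p.
have fw : f w != 0 by rewrite fB fp subr0; apply/eqP.
have ww : '[w, w] != 0.
  apply/eqP; rewrite innerxx => /(@complexI R) /eqP; rewrite sqrf_eq0 => /eqP /rnorm_eq0 w0.
  by move: fw; rewrite w0 f0 eqxx.
exists ((f w / '[w, w])^*%C *: w) => x.
have := orth (x - (f x / f w) *: w).
rewrite fB fZ divfK // subrr -/w => /(_ erefl).
rewrite innerBr innerZr => /eqP; rewrite subr_eq0 => /eqP wx.
rewrite innerZr conjcK (innerC x) wx rmorphM /= conjcK -innerC.
by field; rewrite fw ww.
Qed.

End Projection.

Section Adjoint.
Context {R : realType} {H : hilbertType R}.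
Implicit Types (x y : H) (T : H -> H).

Lemma adjoint_exists T : bounded_operator T ->
  exists S, bounded_operator S /\ forall x y, '[T x, y] = '[x, S y].
Proof.
move=> bT; have linT := op_lin _ bT; have [M M0 TM] := op_bound _ bT.
have /choice[S SP] : forall y, exists w, forall x, '[T x, y] = '[x, w].
  move=> y; apply: (@Riesz_representation _ _ _ (M * rnorm y)).
    by move=> a x z; rewrite linT innerDl innerZl.
  move=> x; apply: le_trans (CauchySchwarz _ _) _.
  by rewrite mulrAC ler_wpM2r // rnorm_ge0.
exists S; split; last by move=> x y; apply: SP.
split=> [a y z|].
  by apply: inner_ext => x; rewrite innerDr innerZr -!SP innerDr innerZr.
exists M => y; have [->|Sy0] := eqVneq (S y) 0.
  by rewrite rnorm0 mulr_ge0 // ?rnorm_ge0 // ltW.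
have Sy : 0 < rnorm (S y).
  by rewrite lt0r rnorm_ge0 andbT; apply: contraNneq Sy0 => /rnorm_eq0 ->.
rewrite -(ler_pM2l Sy) -expr2 -reinnerxx /reinner -SP.
apply: le_trans (reinner_le _ _) _.
by rewrite mulrCA mulrA ler_wpM2r // rnorm_ge0.
Qed.

(** The adjoint is the element selected in a set, and this shows that the set
    is not empty. *)
Lemma adjointP T : bounded_operator T ->
  bounded_operator (adjoint T) /\ forall x y, '[T x, y] = '[x, adjoint T y].
Proof. by move=> /adjoint_exists TS; have := xgetPex (fun=> 0) TS. Qed.

Lemma bounded_adjoint T : bounded_operator T -> bounded_operator (adjoint T).
Proof. by case/adjointP. Qed.

Lemma inner_adjoint T : bounded_operator T ->
  forall x y, '[T x, y] = '[x, adjoint T y].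
Proof. by case/adjointP. Qed.

Lemma adjointK T : bounded_operator T -> adjoint (adjoint T) = T.
Proof.
move=> bT; apply/funext => x; apply: inner_ext => y.
rewrite -(inner_adjoint _ (bounded_adjoint _ bT)) innerC.
by rewrite -(inner_adjoint _ bT) -innerC.
Qed.

Lemma positive_adjoint_comp T : bounded_operator T ->
  positive_operator (adjoint T \o T).
Proof.
move=> bT; split; first exact/bounded_comp/bT/bounded_adjoint.
move=> x /=; rewrite innerC -(inner_adjoint _ bT) innerxx conjc_real.
by rewrite ler0c sqr_ge0.
Qed.

End Adjoint.

(** * The iteration for the square root *)
Section RateConvergence.
Context {R : realType} {H : hilbertType R}.
Implicit Types (u v : nat -> H) (T : H -> H).

Definition rate_cvg u (l : H) : Prop :=
  exists C : R, forall n, rnorm (u n - l) <= C / n.+1%:R.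

Lemma rate_cvg_unique u l l' : rate_cvg u l -> rate_cvg u l' -> l = l'.
Proof.
move=> [C uC] [D uD]; apply/eqP; rewrite -subr_eq0; apply/eqP/rnorm_eq0/le_anti.
rewrite rnorm_ge0 andbT; apply: (@ler0_of_rate _ _ (C + D)) => n.
apply: le_trans (ler_rdistD (u n) _ _) _.
by rewrite mulrDl lerD // rdistC.
Qed.

Lemma rate_cvgD u v l m : rate_cvg u l -> rate_cvg v m ->
  rate_cvg (fun n => u n + v n) (l + m).
Proof.
move=> [C uC] [D uD]; exists (C + D) => n.
by rewrite opprD addrACA mulrDl; apply: le_trans (ler_rnormD _ _) _; apply: lerD.
Qed.

Lemma rate_cvg_op T u l : bounded_operator T -> rate_cvg u l ->
  rate_cvg (fun n => T (u n)) (T l).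
Proof.
move=> bT [C uC]; have [M M0 TM] := op_bound _ bT; exists (M * C) => n.
rewrite -(opB _ (op_lin _ bT)); apply: le_trans (TM _) _.
by rewrite -mulrA ler_pM2l.
Qed.

Lemma rate_cvgZ (a : R[i]) u l : rate_cvg u l -> rate_cvg (fun n => a *: u n) (a *: l).
Proof. by apply: (rate_cvg_op (a \*: idfun)); apply/bounded_scale/bounded_id. Qed.

Lemma rate_cvg_cst l : rate_cvg (fun=> l) l.
Proof. by exists 0 => n; rewrite subrr rnorm0 mul0r. Qed.

Lemma rate_cvg_shift u l : rate_cvg u l -> rate_cvg (fun n => u n.+1) l.
Proof.
move=> [C uC]; exists C => n; apply: le_trans (uC _) _.
have C0 : 0 <= C by have := uC 0%N; rewrite divr1; apply/le_trans/rnorm_ge0.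
by rewrite ler_wpM2l // lef_pV2 ?posrE // ler_nat.
Qed.

End RateConvergence.

Section SquareRootIteration.
Context {R : realType} {H : hilbertType R}.
Implicit Types (A K : H -> H) (x y : H).

(** The fixed point [Y] of [Y = (K + Y^2) / 2] satisfies [(1 - Y)^2 = 1 - K]. *)
Fixpoint sqrt_iter K (n : nat) : H -> H :=
  if n is m.+1
  then fun x => (2^-1 : R)%:C%C *: (K x + sqrt_iter K m (sqrt_iter K m x))
  else fun=> 0.

(** The same iteration for [K = 1], a majorant of the operator iteration when
    [K] is a contraction: [sqrt_iter_step] compares the increments, and the
    series of the increments of the majorant converges since it telescopes. *)
Fixpoint sqrt_iter_bound (n : nat) : R :=
  if n is m.+1 then 2^-1 * (1 + sqrt_iter_bound m ^+ 2) else 0.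

Local Notation b := sqrt_iter_bound.

Lemma sqrt_iter_bound_itv n : 0 <= b n /\ b n <= 1.
Proof. by elim: n => [|n [b0 b1]] /=; [split; lra | split; nra]. Qed.

(** With [z = 1 - sqrt_iter_bound n] one step of the iteration is
    [z - z^2 / 2], and [z <= 2 / (n + 2)] is preserved by that step. *)
Lemma sqrt_iter_bound_rate n : 1 - b n <= 2 / n.+1%:R.
Proof.
suff : (1 - b n) * n.+2%:R <= 2.
  move=> bn; rewrite ler_pdivlMr //; apply: le_trans bn.
  by rewrite ler_wpM2l ?ler_nat // subr_ge0; case: (sqrt_iter_bound_itv n).
elim: n => [|n IH] /=; first by rewrite subr0 mul1r.
have [b0 b1] := sqrt_iter_bound_itv n.
move: IH; rewrite -[n.+3]addn1 natrD; set k : R := n.+2%:R => IH.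
have k2 : 2 <= k by rewrite ler_nat.
move: b1 b0 IH; set z := 1 - b n; have -> : b n = 1 - z by rewrite /z; ring.
move=> z0 z1 IH.
have -> : 1 - 2^-1 * (1 + (1 - z) ^+ 2) = z - z ^+ 2 / 2 by field.
nra.
Qed.

(** The value of one universal polynomial at [K] is [sqrt_iter K n]; this is
    the form in which that fact is used. *)
Lemma sqrt_iter_intertwine A K K' : linear A -> (forall x, A (K x) = K' (A x)) ->
  forall n x, A (sqrt_iter K n x) = sqrt_iter K' n (A x).
Proof.
move=> linA AK; elim=> [|n IH] x /=; first exact: op0.
by rewrite (opZ _ linA) (opD _ linA) AK !IH.
Qed.

Section Contraction.
Variables (K : H -> H) (linK : linear K) (K1 : forall x, rnorm (K x) <= rnorm x).

Lemma sqrt_iter_linear n : linear (sqrt_iter K n).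
Proof.
elim: n => [|n IH] a x y /=; first by rewrite scaler0 addr0.
rewrite linK !IH scalerA mulrC -scalerA -scalerDr; congr (_ *: _).
by rewrite scalerDr addrACA.
Qed.

Lemma sqrt_iter_comm n m x :
  sqrt_iter K n (sqrt_iter K m x) = sqrt_iter K m (sqrt_iter K n x).
Proof.
apply: sqrt_iter_intertwine (sqrt_iter_linear n) _ _ _ => {}x.
by apply: esym; apply: sqrt_iter_intertwine.
Qed.

Lemma sqrt_iter_le n x : rnorm (sqrt_iter K n x) <= b n * rnorm x.
Proof.
elim: n x => [|n IH] x /=; first by rewrite rnorm0 mul0r.
rewrite rnormZ rnorm_real ger0_norm ?invr_ge0 // -mulrA ler_pM2l ?invr_gt0 //.
apply: le_trans (ler_rnormD _ _) _; rewrite mulrDl mul1r lerD //.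
apply: le_trans (IH _) _; rewrite expr2 -mulrA ler_wpM2l //.
by case: (sqrt_iter_bound_itv n).
Qed.

(** As the iterates commute, [Y_(n+2) - Y_(n+1)] factors as
    [(Y_(n+1) + Y_n) (Y_(n+1) - Y_n) / 2], exactly like the majorant. *)
Lemma sqrt_iter_step n x :
  rnorm (sqrt_iter K n.+1 x - sqrt_iter K n x) <= (b n.+1 - b n) * rnorm x.
Proof.
have half (y : H) : rnorm ((2^-1 : R)%:C%C *: y) = 2^-1 * rnorm y.
  by rewrite rnormZ rnorm_real ger0_norm ?invr_ge0.
elim: n x => [|n IH] x.
  rewrite /= addr0 !subr0 expr0n /= addr0 mulr1 half.
  by rewrite ler_pM2l ?invr_gt0.
pose Y := sqrt_iter K; pose u := Y n.+1 x; pose v := Y n x.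
have YS m z : Y m.+1 z = (2^-1 : R)%:C%C *: (K z + Y m (Y m z)) by [].
have YB m z w : Y m (z - w) = Y m z - Y m w := opB _ (sqrt_iter_linear m) z w.
have Yuv : Y n.+2 x - Y n.+1 x = (2^-1 : R)%:C%C *: (Y n.+1 (u - v) + Y n (u - v)).
  rewrite (YS n.+1) [in X in _ - X]YS -scalerBr opprD addrACA subrr add0r !YB.
  by rewrite [Y n u]sqrt_iter_comm addrA subrK.
rewrite -/Y Yuv {Yuv}.
rewrite half.
have -> : b n.+2 - b n.+1 = 2^-1 * ((b n.+1 + b n) * (b n.+1 - b n)).
  have bS m : b m.+1 = 2^-1 * (1 + b m ^+ 2) by [].
  by rewrite (bS n.+1) [X in _ - X = _]bS; ring.
rewrite -mulrA ler_pM2l ?invr_gt0 //.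
have [b0 _] := sqrt_iter_bound_itv n; have [b1 _] := sqrt_iter_bound_itv n.+1.
apply: le_trans (ler_rnormD _ _) _.
rewrite -mulrA mulrDl; apply: lerD; apply: le_trans (sqrt_iter_le _ _) _;
  by apply: ler_wpM2l => //; apply: IH.
Qed.

Lemma sqrt_iter_cauchy n m x : (n <= m)%N ->
  rnorm (sqrt_iter K m x - sqrt_iter K n x) <= 2 * rnorm x / n.+1%:R.
Proof.
move=> nm; apply: (@le_trans _ _ ((b m - b n) * rnorm x)); last first.
  rewrite mulrAC ler_wpM2r ?rnorm_ge0 //; apply: le_trans (sqrt_iter_bound_rate n).
  by rewrite lerD2r; case: (sqrt_iter_bound_itv m).
elim: m nm => [|m IH]; first by rewrite leqn0 => /eqP ->; rewrite !subrr rnorm0 mul0r.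
rewrite leq_eqVlt => /predU1P[->|]; first by rewrite !subrr rnorm0 mul0r.
rewrite ltnS => /IH le_m; apply: le_trans (ler_rdistD (sqrt_iter K m x) _ _) _.
have := sqrt_iter_step m x; move: le_m; rewrite !mulrBl; lra.
Qed.

Lemma sqrt_iter_limit : exists Y : H -> H,
  [/\ linear Y, forall x, rnorm (Y x) <= rnorm x,
      forall x, K x + Y (Y x) = Y x + Y x &
      forall x, rate_cvg (sqrt_iter K ^~ x) (Y x)].
Proof.
have /choice[Y YP] x := rate_complete _ _ (fun n m => @sqrt_iter_cauchy n m x).
have Ycvg x : rate_cvg (sqrt_iter K ^~ x) (Y x) by exists (2 * rnorm x).
exists Y; split=> //.
- move=> a x y; apply: rate_cvg_unique (Ycvg _) _.
  have [C xyC] := rate_cvgD _ _ _ _ (rate_cvgZ a _ _ (Ycvg x)) (Ycvg y).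
  by exists C => n; rewrite sqrt_iter_linear.
- move=> x; rewrite -subr_le0; apply: (@ler0_of_rate _ _ (2 * rnorm x)) => n.
  have [_ b1] := sqrt_iter_bound_itv n.
  have := sqrt_iter_le n x; have := ler_wpM2r (rnorm_ge0 x) b1; have := YP x n.
  have := ler_rnormD (Y x - sqrt_iter K n x) (sqrt_iter K n x).
  rewrite subrK rdistC; move: (_ / n.+1%:R) => r; lra.
- move=> x; suff YE : Y x = (2^-1 : R)%:C%C *: (K x + Y (Y x)).
    by rewrite [in RHS]YE -scalerDl -rmorphD /= -div1r -splitr scale1r.
  apply: rate_cvg_unique (rate_cvg_shift _ _ (Ycvg x)) _ => /=.
  apply: rate_cvgZ; apply: rate_cvgD; first exact: rate_cvg_cst.
  exists (2 * rnorm x + 2 * rnorm (Y x)) => n; rewrite mulrDl.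
  apply: le_trans (ler_rdistD (sqrt_iter K n (Y x)) _ _) _; apply: lerD (YP _ _).
  rewrite -(opB _ (sqrt_iter_linear n)); apply: le_trans (sqrt_iter_le _ _) _.
  have [b0 b1] := sqrt_iter_bound_itv n.
  by apply: le_trans (YP x n); rewrite -[leRHS]mul1r ler_wpM2r // rnorm_ge0.
Qed.

Lemma sqrt_iter_symmetric : (forall x y, '[K x, y] = '[x, K y]) ->
  forall n x y, '[sqrt_iter K n x, y] = '[x, sqrt_iter K n y].
Proof.
move=> symK; elim=> [|n IH] x y /=; first by rewrite inner0l inner0r.
by rewrite innerZl innerZr conjc_real innerDl innerDr symK !IH.
Qed.

End Contraction.
End SquareRootIteration.

(** * Positive square roots *)
Section SquareRoot.
Context {R : realType} {H : hilbertType R}.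
Implicit Types (A S T Q : H -> H) (x y : H) (c : R).

(** The operator [1 - T / c], a contraction when [T] is positive and bounded by
    [c]; the scale [c] is a parameter because intertwining two square roots
    requires the same scale for both. *)
Definition sqrt_defect c T x : H := x - (c^-1)%:C%C *: T x.

Definition sqrt_approx c T (n : nat) x : H :=
  (Num.sqrt c)%:C%C *: (x - sqrt_iter (sqrt_defect c T) n x).

Lemma sqrt_approx_intertwine c A T T' : linear A ->
  (forall x, A (T x) = T' (A x)) ->
  forall n x, A (sqrt_approx c T n x) = sqrt_approx c T' n (A x).
Proof.
move=> linA AT n x; rewrite /sqrt_approx (opZ _ linA) (opB _ linA).
congr (_ *: (_ - _)); apply: sqrt_iter_intertwine => // {}x.
by rewrite /sqrt_defect (opB _ linA) (opZ _ linA) AT.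
Qed.

(** Expanding [|x - T x / c|^2], the claim amounts to [|T x|^2 <= c <T x, x>],
    up to a factor [2]; this is Cauchy-Schwarz for the form of [T], applied to
    [x] and [T x]. *)
Lemma sqrt_defect_le c T : 0 < c -> linear T -> (forall x, 0 <= '[T x, x]) ->
  (forall x, rnorm (T x) <= c * rnorm x) ->
  forall x, rnorm (sqrt_defect c T x) <= rnorm x.
Proof.
move=> c0 linT posT Tc x.
have TxT : rnorm (T x) ^+ 2 <= c * reinner (T x) x.
  have := pos_CauchySchwarz _ linT posT x (T x).
  rewrite innerxx rnorm_real ger0_norm ?sqr_ge0 // => CS.
  have [->|Tx0] := eqVneq (T x) 0; first by rewrite rnorm0 expr0n /reinner inner0l mulr0.
  have Tx : 0 < rnorm (T x).
    by rewrite lt0r rnorm_ge0 andbT; apply: contraNneq Tx0 => /rnorm_eq0 ->.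
  have TTx : reinner (T (T x)) (T x) <= c * rnorm (T x) ^+ 2.
    apply: le_trans (reinner_le _ _) _; rewrite expr2 mulrA ler_pM2r //.
  have := ler_wpM2l (pos_reinner_ge0 _ posT x) TTx => /(le_trans CS).
  by rewrite [_ ^+ 2 ^+ 2]expr2 (mulrA (reinner _ _)) ler_pM2r ?exprn_gt0 // mulrC.
rewrite -(ler_pXn2r (n := 2)) ?nnegrE ?rnorm_ge0 // /sqrt_defect.
rewrite -reinnerxx !reinnerE (reinnerC x (T x)) !reinnerxx.
set d := c^-1; set q := reinner (T x) x in TxT *; set p := rnorm (T x) ^+ 2 in TxT *.
have d0 : 0 < d by rewrite invr_gt0.
have dp : d * (d * p) <= d * q.
  by rewrite ler_pM2l // ler_pdivrMl.
have := mulr_ge0 (ltW d0) (pos_reinner_ge0 _ posT x); rewrite -/q; lra.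
Qed.

Lemma sqrt_approx_limit c T : 0 < c -> positive_operator T ->
  (forall x, rnorm (T x) <= c * rnorm x) ->
  exists Q, [/\ positive_operator Q, Q \o Q = T &
                forall x, rate_cvg (sqrt_approx c T ^~ x) (Q x)].
Proof.
move=> c0 [bT posT] Tc; have linT := op_lin _ bT.
set K := sqrt_defect c T.
have linK : linear K.
  move=> a x y; rewrite /K /sqrt_defect linT scalerDr scalerBr !scalerA.
  by rewrite (mulrC a) opprD addrACA.
have K1 : forall x, rnorm (K x) <= rnorm x by apply: sqrt_defect_le.
have symK x y : '[K x, y] = '[x, K y].
  rewrite /K /sqrt_defect innerBl innerBr innerZl innerZr conjc_real.
  by rewrite (pos_symmetric _ linT posT).
have [Y [linY Y1 YE Ycvg]] := sqrt_iter_limit K linK K1.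
have symY x y : '[Y x, y] = '[x, Y y].
  apply/eqP; rewrite -subr_eq0; apply/eqP/rnorm_eq0/le_anti; rewrite rnorm_ge0 andbT.
  have [C xC] := Ycvg x; have [D yD] := Ycvg y.
  apply: (@ler0_of_rate _ _ (C * rnorm y + rnorm x * D)) => n.
  have -> : '[Y x, y] - '[x, Y y] =
     '[x, sqrt_iter K n y - Y y] - '[sqrt_iter K n x - Y x, y].
    by rewrite innerBl innerBr (sqrt_iter_symmetric K symK); ring.
  rewrite addrC mulrDl; apply: le_trans (ler_rnormD _ _) _; rewrite rnormN.
  apply: lerD; apply: le_trans (CauchySchwarz _ _) _.
    by rewrite mulrAC ler_wpM2r ?rnorm_ge0.
  by rewrite -mulrA ler_wpM2l ?rnorm_ge0.
have bY : bounded_operator Y by split=> //; exists 1 => x; rewrite mul1r.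
pose Q := (Num.sqrt c)%:C%C \*: (idfun \+ (-1) \*: Y).
have QE x : Q x = (Num.sqrt c)%:C%C *: (x - Y x) by rewrite /Q /= scaleN1r.
exists Q; split; first split.
- by apply: bounded_scale; apply: bounded_add; [exact: bounded_id|exact: bounded_scale].
- move=> x; rewrite QE innerZl mulr_ge0 ?ler0c ?sqrtr_ge0 // innerBl.
  have Yreal : '[Y x, x] = (reinner (Y x) x)%:C%C.
    rewrite /reinner RRe_real //; apply/complex_realP; exists (reinner (Y x) x).
    have := symY x x; rewrite (innerC x) /reinner; case: '[Y x, x] => a b /= [bb].
    by congr (_ +i* _)%C; lra.
  rewrite Yreal innerxx -rmorphB ler0c subr_ge0 /=.
  apply: le_trans (reinner_le _ _) _.
  by rewrite expr2 ler_wpM2r // rnorm_ge0.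
- apply/funext => x; rewrite /= !QE (opZ _ linY) -scalerBr scalerA.
  rewrite -rmorphM /= -expr2 sqr_sqrtr ?(ltW c0) //.
  have KE : K x = Y x + Y x - Y (Y x) by rewrite -YE addrK.
  have -> : x - Y x - Y (x - Y x) = x - K x.
    by rewrite KE (opB _ linY) !opprB -addrA (addrCA (- Y x)) -opprD.
  by rewrite /K /sqrt_defect opprB addrC subrK scalerA -rmorphM /= mulfV ?gt_eqF // scale1r.
- move=> x; rewrite QE; apply: rate_cvgZ; apply: rate_cvgD; first exact: rate_cvg_cst.
  have [C xC] := Ycvg x; exists C => n.
  by rewrite -opprD rnormN.
Qed.

(** For [y = S x - Q x], commutation gives [(S + Q) y = 0], so the two
    nonnegative numbers [<S y, y>] and [<Q y, y>] vanish.  Hence [S y = Q y = 0]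
    and [|y|^2 = <y, (S - Q) x> = <(S - Q) y, x> = 0]. *)
Lemma sqrt_unique S Q : positive_operator S -> positive_operator Q ->
  S \o S = Q \o Q -> (forall x, S (Q x) = Q (S x)) -> S = Q.
Proof.
move=> [bS posS] [bQ posQ] /funeqP SQ comm.
have linS := op_lin _ bS; have linQ := op_lin _ bQ.
apply/funext => x; apply/eqP; rewrite -subr_eq0; apply/eqP.
pose y := S x - Q x.
have SQy : S y + Q y = 0.
  rewrite /y (opB _ linS) (opB _ linQ) addrA comm subrK.
  by apply/eqP; rewrite subr_eq0; apply/eqP/SQ.
have Sy0 := pos_reinner_ge0 _ posS y; have Qy0 := pos_reinner_ge0 _ posQ y.
have sum0 : reinner (S y) y + reinner (Q y) y = 0.
  by rewrite -reinnerDl SQy /reinner inner0l.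
have Sy : S y = 0 by apply: (pos_op0 _ linS posS); lra.
have Qy : Q y = 0 by apply: (pos_op0 _ linQ posQ); lra.
apply: rnorm_eq0; apply/eqP; rewrite -sqrf_eq0 -reinnerxx -/y {2}/y.
rewrite reinnerDr reinnerNr -(pos_reinner_sym _ linS posS).
by rewrite -(pos_reinner_sym _ linQ posQ) Sy Qy subrr.
Qed.

(** A square root of [T] commutes with [T], hence with the approximants and
    with their limit, so uniqueness among commuting square roots applies to any
    positive square root. *)
Lemma positive_sqrt_approx c T S : 0 < c -> positive_operator T ->
  (forall x, rnorm (T x) <= c * rnorm x) ->
  positive_operator S -> S \o S = T ->
  forall x, rate_cvg (sqrt_approx c T ^~ x) (S x).
Proof.
move=> c0 posT Tc posS ST; have [Q [posQ QT Qcvg]] := sqrt_approx_limit c T c0 posT Tc.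
have [bS _] := posS; have linS := op_lin _ bS.
suff -> : S = Q by [].
apply: sqrt_unique => //; first by rewrite ST QT.
move=> x; apply: rate_cvg_unique (rate_cvg_op _ _ _ bS (Qcvg x)) _.
have [C SxC] := Qcvg (S x); exists C => n.
by rewrite (@sqrt_approx_intertwine c S T T) // => y; rewrite -ST.
Qed.

Lemma sqrt_operatorP T : positive_operator T ->
  positive_operator (sqrt_operator T) /\ sqrt_operator T \o sqrt_operator T = T.
Proof.
move=> posT; have [bT _] := posT; have [c c0 Tc] := op_bound _ bT.
have [Q [posQ QT _]] := sqrt_approx_limit c T c0 posT Tc.
have sqrtT : exists S, positive_operator S /\ S \o S = T by exists Q.
by have := xgetPex (fun=> 0) sqrtT.
Qed.

(** Both square roots are limits of the same polynomials, at a common scale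
    bounding both operators. *)
Lemma sqrt_operator_intertwine A T T' : bounded_operator A ->
  positive_operator T -> positive_operator T' ->
  (forall x, A (T x) = T' (A x)) ->
  forall x, A (sqrt_operator T x) = sqrt_operator T' (A x).
Proof.
move=> bA posT posT' AT x.
have [c c0 Tc] := op_bound _ posT.1; have [d d0 T'd] := op_bound _ posT'.1.
have e0 := addr_gt0 c0 d0.
have Te y : rnorm (T y) <= (c + d) * rnorm y.
  by apply: le_trans (Tc y) _; rewrite ler_wpM2r ?rnorm_ge0 // lerDl ltW.
have T'e y : rnorm (T' y) <= (c + d) * rnorm y.
  by apply: le_trans (T'd y) _; rewrite ler_wpM2r ?rnorm_ge0 // lerDr ltW.
have [posS ST] := sqrt_operatorP _ posT; have [posS' ST'] := sqrt_operatorP _ posT'.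
have cvgS := positive_sqrt_approx _ _ _ e0 posT Te posS ST.
have cvgS' := positive_sqrt_approx _ _ _ e0 posT' T'e posS' ST'.
apply: rate_cvg_unique (rate_cvg_op _ _ _ bA (cvgS x)) _.
have [C AxC] := cvgS' (A x); exists C => n.
by rewrite (@sqrt_approx_intertwine _ _ T T') //; apply: op_lin.
Qed.

End SquareRoot.

(** * Moduli and the mixed Schwarz inequality *)
Section AbsoluteValue.
Context {R : realType} {H : hilbertType R}.
Implicit Types (A : H -> H) (x y : H).

Lemma abs_operator_pos A : bounded_operator A -> positive_operator (abs_operator A).
Proof. by move=> bA; case: (sqrt_operatorP _ (positive_adjoint_comp _ bA)). Qed.

Lemma abs_operator_sqr A x : bounded_operator A ->
  abs_operator A (abs_operator A x) = adjoint A (A x).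
Proof.
move=> bA; have [_ /funeqP sq] := sqrt_operatorP _ (positive_adjoint_comp _ bA).
exact: sq.
Qed.

Lemma abs_operator_sqr_inner A x : bounded_operator A ->
  '[abs_operator A (abs_operator A x), x] = (rnorm (A x) ^+ 2)%:C%C.
Proof.
by move=> bA; rewrite abs_operator_sqr // innerC -inner_adjoint // innerxx conjc_real.
Qed.

(** This is [A (A' A) = (A A') A], carried over to the square roots. *)
Lemma abs_operator_intertwine A x : bounded_operator A ->
  A (abs_operator A x) = abs_operator (adjoint A) (A x).
Proof.
move=> bA; have bA' := bounded_adjoint _ bA.
apply: sqrt_operator_intertwine => //; try exact: positive_adjoint_comp.
by move=> y; rewrite /= adjointK.
Qed.

(** For [x = P z] with [P = |A|] and [Q = |A'|], the relation [A P = Q A]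
    turns [<A x, y>] into [<Q A z, y>], and [<Q A z, A z> = <P x, x>].  Any [x]
    may be replaced by its projection [p] on the closure of the range of [P],
    because [x - p] is killed by [P], hence by [A]. *)
Lemma mixed_Schwarz A x y : bounded_operator A ->
  rnorm '[A x, y] ^+ 2 <=
  reinner (abs_operator A x) x * reinner (abs_operator (adjoint A) y) y.
Proof.
move=> bA; have linA := op_lin _ bA; have bA' := bounded_adjoint _ bA.
pose P := abs_operator A; pose Q := abs_operator (adjoint A).
have [bP posP] : positive_operator P := abs_operator_pos _ bA.
have [bQ posQ] : positive_operator Q := abs_operator_pos _ bA'.
have linP := op_lin _ bP; have linQ := op_lin _ bQ.
rewrite -/P -/Q.
have PQ z : A (P z) = Q (A z) := abs_operator_intertwine _ z bA.
have Pnorm z : rnorm (A z) ^+ 2 = rnorm (P z) ^+ 2.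
  rewrite -[RHS]reinnerxx -(pos_reinner_sym _ linP posP) /reinner.
  by rewrite abs_operator_sqr_inner.
have on_range z : rnorm '[A (P z), y] ^+ 2 <= reinner (P (P z)) (P z) * reinner (Q y) y.
  have -> : reinner (P (P z)) (P z) = reinner (Q (A z)) (A z).
    by rewrite -PQ [RHS]/reinner inner_adjoint // -abs_operator_sqr // reinnerC.
  rewrite PQ; exact: (pos_CauchySchwarz _ linQ posQ).
have [||p orth [k kP]] := orthogonal_projection (fun w => exists z, w = P z) x.
- by exists 0; rewrite op0.
- by move=> a _ _ [z ->] [w ->]; exists (a *: z + w); rewrite linP.
have Pxp : P x = P p.
  apply/eqP; rewrite -subr_eq0 -(opB _ linP); apply/eqP/rnorm_eq0/eqP.
  rewrite -sqrf_eq0 -reinnerxx (pos_reinner_sym _ linP posP) /reinner.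
  by rewrite orth //; exists (P (x - p)).
have Axp : A x = A p.
  apply/eqP; rewrite -subr_eq0 -(opB _ linA); apply/eqP/rnorm_eq0/eqP.
  by rewrite -sqrf_eq0 Pnorm (opB _ linP) Pxp subrr rnorm0 expr0n.
have -> : reinner (P x) x = reinner (P p) p.
  by rewrite Pxp (pos_reinner_sym _ linP posP) Pxp -(pos_reinner_sym _ linP posP).
rewrite Axp.
have [M M0 AM] := op_bound _ bA; have [N N0 PN] := op_bound _ bP.
set a := rnorm '[A p, y]; set s := reinner (P p) p; set q := reinner (Q y) y.
have q0 : 0 <= q by apply: pos_reinner_ge0 posQ _.
have a0 : 0 <= a by apply: rnorm_ge0.
pose e := M * rnorm y; have e0 : 0 <= e by rewrite mulr_ge0 ?rnorm_ge0 // ltW.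
(* The inequality at [p] fails by at most a multiple of [|k n - p|], which is
   at most [2 / (n + 1)]; [C] is the factor. *)
pose C := (2 * N + 2 * (N * rnorm p)) * q + 2 * a * e + 6 * e ^+ 2.
have C0 : 0 <= C.
  by rewrite !addr_ge0 ?mulr_ge0 ?sqr_ge0 ?addr_ge0 ?mulr_ge0 ?rnorm_ge0 // ltW.
rewrite -subr_le0; apply: (@ler0_of_rate _ _ (C * 2)) => n.
have [[z kz] kp] := kP n; have := on_range z; rewrite -kz -/q.
set w := k n in kp *; set d := rnorm (w - p) in kp.
have d0 : 0 <= d by apply: rnorm_ge0.
have d2 : d <= 2.
  by apply: le_trans kp _; rewrite ler_pdivrMr // ler_pMr // ler1n.
have Adiff : `|a - rnorm '[A w, y]| <= d * e.
  have Awp : rnorm '[A (w - p), y] <= d * e.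
    apply: le_trans (CauchySchwarz _ _) _; rewrite /e mulrA ler_wpM2r ?rnorm_ge0 // mulrC.
    exact: AM.
  rewrite ler_norml; apply/andP; split.
    have := ler_rnormD '[A (w - p), y] '[A p, y].
    by rewrite -innerDl -(opD _ linA) subrK -/a; lra.
  have := ler_rnormD (- '[A (w - p), y]) '[A w, y].
  rewrite rnormN -innerNl -innerDl -(opN _ linA) -(opD _ linA) opprB subrK -/a.
  by lra.
have Pdiff : reinner (P w) w - s <= d * (2 * N + 2 * (N * rnorm p)).
  have -> : reinner (P w) w - s =
      reinner (P (w - p)) (w - p) + 2 * reinner (P p) (w - p).
    rewrite (opB _ linP) !reinnerE /s (pos_reinner_sym _ linP posP w p).
    by rewrite (reinnerC w); ring.
  have := reinner_le (P (w - p)) (w - p); have := reinner_le (P p) (w - p).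
  have := ler_wpM2r d0 (PN (w - p)); have := ler_wpM2r d0 (PN p).
  have := ler_wpM2l (ltW N0) (ler_wpM2l d0 d2).
  by rewrite -/d; lra.
have : d * C <= C * 2 / n.+1%:R by rewrite mulrC -mulrA ler_wpM2l.
move: Adiff; set aw := rnorm _; set r := C * 2 / _ => Adiff dC aw2.
suff : a ^+ 2 - s * q <= d * C by move=> /le_trans; apply.
have Pdiffq := ler_wpM2r q0 Pdiff.
have aw0 : 0 <= aw by apply: rnorm_ge0.
have [le1 le2] : aw - a <= d * e /\ a - aw <= d * e.
  by move: Adiff; rewrite ler_norml => /andP[]; split; lra.
have de0 := mulr_ge0 d0 e0.
have h1 : a ^+ 2 <= (aw + d * e) ^+ 2.
  by apply: lerXn2r; rewrite ?nnegrE ?addr_ge0 //; lra.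
have h2 := ler_wpM2r de0 le1.
have h3 : (d * e) ^+ 2 <= 2 * (d * e ^+ 2).
  by have := ler_wpM2r (mulr_ge0 d0 (sqr_ge0 e)) d2; lra.
rewrite /C; lra.
Qed.

End AbsoluteValue.

(** * Numerical radius *)
Section NumericalRadius.
Context {R : realType} {H : hilbertType R}.
Implicit Types (A B T P S : H -> H) (x y : H).

Lemma numerical_radius_has_ubound T : bounded_operator T ->
  has_ubound [set rnorm '[T x, x] | x in [set x | rnorm x = 1]]%classic.
Proof.
move=> /op_bound[M M0 TM]; exists M => _ [x /= x1 <-].
by apply: le_trans (CauchySchwarz _ _) _; rewrite x1 mulr1; have := TM x; rewrite x1 mulr1.
Qed.

(** On the zero space the supremum is over the empty set, and is [0] by
    convention. *)
Lemma numerical_radius_ge0 T : bounded_operator T -> 0 <= numerical_radius T.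
Proof.
move=> bT; rewrite /numerical_radius; set E := (X in sup X).
have [->|/set0P[r Er]] := eqVneq E set0; first by rewrite sup0.
apply: le_trans (ub_le_sup (numerical_radius_has_ubound _ bT) Er).
by case: Er => x _ <-; apply: rnorm_ge0.
Qed.

Lemma numerical_radius_ge T x : bounded_operator T ->
  rnorm '[T x, x] <= numerical_radius T * rnorm x ^+ 2.
Proof.
move=> bT; have linT := op_lin _ bT; have [->|x0] := eqVneq x 0.
  by rewrite inner0r !rnorm0 expr0n mulr0.
have X0 : 0 < rnorm x.
  by rewrite lt0r rnorm_ge0 andbT; apply: contraNneq x0 => /rnorm_eq0 ->.
pose e := (rnorm x)^-1; have e0 : 0 < e by rewrite invr_gt0.
have rnorme : rnorm (e%:C%C : R[i]) = e by rewrite rnorm_real gtr0_norm.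
rewrite -ler_pdivrMr ?exprn_gt0 //; apply: (ub_le_sup (numerical_radius_has_ubound _ bT)).
exists (e%:C%C *: x); first by rewrite /= rnormZ rnorme mulVf ?gt_eqF.
rewrite (opZ _ linT) innerZl innerZr conjc_real !rnormcM rnorme.
by rewrite mulrA mulrC -expr2 exprVn.
Qed.

(** [<P x, x>] and [<S x, x>] are the real and the imaginary part of
    [<(P + iS) x, x>]. *)
Lemma numerical_radius_pair P S x : positive_operator P -> positive_operator S ->
  reinner (P x) x ^+ 2 + reinner (S x) x ^+ 2 <=
  (numerical_radius (P \+ 'i%C \*: S) * rnorm x ^+ 2) ^+ 2.
Proof.
move=> [bP posP] [bS posS].
have bPS : bounded_operator (P \+ 'i%C \*: S) by apply/bounded_add/bounded_scale.
have <- : rnorm '[(P \+ 'i%C \*: S) x, x] ^+ 2 = reinner (P x) x ^+ 2 + reinner (S x) x ^+ 2.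
  rewrite sqr_rnormc /= innerDl innerZl (pos_innerE _ posP) (pos_innerE _ posS).
  by simpc.
by apply: lerXn2r (numerical_radius_ge _ _ bPS);
  rewrite ?nnegrE ?mulr_ge0 ?rnorm_ge0 ?numerical_radius_ge0 ?sqr_ge0.
Qed.

Lemma positive_operator_sqr P : positive_operator P -> positive_operator (P \o P).
Proof.
move=> [bP posP]; split; first exact: bounded_comp.
move=> x; rewrite /= (pos_symmetric _ (op_lin _ bP) posP) innerxx.
by rewrite ler0c sqr_ge0.
Qed.

Lemma numerical_radius_abs_sqr A B x : bounded_operator A -> bounded_operator B ->
  (rnorm (A x) ^+ 2) ^+ 2 + (rnorm (B x) ^+ 2) ^+ 2 <=
  (numerical_radius ((abs_operator A \o abs_operator A) \+
        'i%C \*: (abs_operator B \o abs_operator B)) * rnorm x ^+ 2) ^+ 2.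
Proof.
move=> bA bB.
have absE (T : H -> H) : bounded_operator T ->
    rnorm (T x) ^+ 2 = reinner ((abs_operator T \o abs_operator T) x) x.
  by move=> bT; rewrite /reinner /= abs_operator_sqr_inner.
rewrite (absE A) // (absE B) //.
by apply: numerical_radius_pair; apply/positive_operator_sqr/abs_operator_pos.
Qed.

Lemma ler_dot2 (p q r s m n : R) : 0 <= m -> 0 <= n ->
  p ^+ 2 + q ^+ 2 <= m ^+ 2 -> r ^+ 2 + s ^+ 2 <= n ^+ 2 -> p * r + q * s <= m * n.
Proof.
move=> m0 n0 pq rs; apply: le_trans (ler_norm _) _.
rewrite -(ler_pXn2r (n := 2)) ?nnegrE ?mulr_ge0 // real_normK ?num_real // exprMn.
apply: le_trans (_ : (p ^+ 2 + q ^+ 2) * (r ^+ 2 + s ^+ 2) <= _); last first.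
  by apply: ler_pM; rewrite ?addr_ge0 ?sqr_ge0.
have := sqr_ge0 (p * s - q * r); lra.
Qed.

(** Cauchy-Schwarz for [x] and [z = <x, u> u + <x, v> v], where
    [<x, z> = |<x, u>|^2 + |<x, v>|^2].  The term in [<u, v>] is what keeps
    the bound sharp: for a unit vector [x = u], it is an equality both when
    [v = u] and when [v] is orthogonal to [u]. *)
Lemma sum_sqr_inner_le (x u v : H) :
  (rnorm '[x, u] ^+ 2 + rnorm '[x, v] ^+ 2) ^+ 2 <=
  rnorm x ^+ 2 * (rnorm '[x, u] ^+ 2 * rnorm u ^+ 2 +
    rnorm '[x, v] ^+ 2 * rnorm v ^+ 2 +
    2 * (rnorm '[x, u] * rnorm '[x, v]) * rnorm '[u, v]).
Proof.
set al := '[x, u]; set be := '[x, v].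
have normC (z : R[i]) : z^*%C * z = (rnorm z ^+ 2)%:C%C.
  by rewrite rmorphXn /= -rnorm_complex sqr_normc mulrC.
pose z := al *: u + be *: v.
have xz : reinner x z = rnorm al ^+ 2 + rnorm be ^+ 2.
  by rewrite /reinner innerDr !innerZr !normC -rmorphD.
have zz : rnorm z ^+ 2 <= rnorm al ^+ 2 * rnorm u ^+ 2 +
    rnorm be ^+ 2 * rnorm v ^+ 2 + 2 * (rnorm al * rnorm be) * rnorm '[u, v].
  rewrite -[leLHS]reinnerxx reinnerDl !reinnerDr !reinnerxx !rnormZ !exprMn.
  rewrite (reinnerC (be *: v)).
  have := ler_Re_rnorm '[al *: u, be *: v].
  rewrite innerZl innerZr !rnormcM rnormcJ -innerZr -innerZl -/(reinner _ _).
  lra.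
have xz0 : 0 <= reinner x z by rewrite xz addr_ge0 ?sqr_ge0.
rewrite -xz; apply: le_trans (ler_wpM2l (sqr_ge0 _) zz); rewrite -exprMn.
by apply: lerXn2r (reinner_le _ _); rewrite ?nnegrE ?mulr_ge0 ?rnorm_ge0.
Qed.

End NumericalRadius.

(** * The bound on the Euclidean norm *)
Section EuclideanNorm.
Context {R : realType} {H : hilbertType R}.
Variables (A B : H -> H) (hA : bounded_operator A) (hB : bounded_operator B).
Implicit Types (x y : H).

Let bA' := bounded_adjoint _ hA.
Let bB' := bounded_adjoint _ hB.

Let w1 := numerical_radius ((abs_operator A \o abs_operator A) \+
            'i%C \*: (abs_operator B \o abs_operator B)).
Let w2 := numerical_radius
            ((abs_operator (adjoint A) \o abs_operator (adjoint A)) \+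
             'i%C \*: (abs_operator (adjoint B) \o abs_operator (adjoint B))).
Let w3 := numerical_radius (abs_operator A \+ 'i%C \*: abs_operator B).
Let w4 := numerical_radius
            (abs_operator (adjoint A) \+ 'i%C \*: abs_operator (adjoint B)).
Let w5 := numerical_radius (B \o adjoint A).
Let W := w1 * w2 + w3 * w4 * w5.

Let w_ge0 : [/\ 0 <= w1, 0 <= w2, 0 <= w3, 0 <= w4 & 0 <= w5].
Proof.
have bP (T : H -> H) : bounded_operator T -> bounded_operator (abs_operator T).
  by move=> /abs_operator_pos[].
have bPS (P S : H -> H) : bounded_operator P -> bounded_operator S ->
    bounded_operator (P \+ 'i%C \*: S).
  by move=> ? ?; apply/bounded_add/bounded_scale.
have bPP (T : H -> H) : bounded_operator T ->
    bounded_operator (abs_operator T \o abs_operator T).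
  by move=> /bP ?; apply: bounded_comp.
split; apply: numerical_radius_ge0.
- exact: bPS (bPP _ hA) (bPP _ hB).
- exact: bPS (bPP _ bA') (bPP _ bB').
- exact: bPS (bP _ hA) (bP _ hB).
- exact: bPS (bP _ bA') (bP _ bB').
- exact: bounded_comp hB bA'.
Qed.

Lemma sum_sqr_inner_numerical_radius x y :
  (rnorm '[A x, y] ^+ 2 + rnorm '[B x, y] ^+ 2) ^+ 2 <=
  W * (rnorm x ^+ 2 * rnorm y ^+ 2) ^+ 2.
Proof.
have [W1 W2 W3 W4 W5] := w_ge0.
have x2 : 0 <= rnorm x ^+ 2 := sqr_ge0 _; have y2 : 0 <= rnorm y ^+ 2 := sqr_ge0 _.
have sqr_inner_le (T : H -> H) : rnorm '[T x, y] ^+ 2 <= rnorm (T x) ^+ 2 * rnorm y ^+ 2.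
  rewrite -exprMn; apply: lerXn2r (CauchySchwarz _ _);
  by rewrite ?nnegrE ?mulr_ge0 ?rnorm_ge0.
have sqrs : rnorm '[A x, y] ^+ 2 * rnorm (adjoint A y) ^+ 2 +
    rnorm '[B x, y] ^+ 2 * rnorm (adjoint B y) ^+ 2 <=
    w1 * rnorm x ^+ 2 * (w2 * rnorm y ^+ 2) * rnorm y ^+ 2.
  have := ler_wpM2r (sqr_ge0 (rnorm (adjoint A y))) (sqr_inner_le A).
  have := ler_wpM2r (sqr_ge0 (rnorm (adjoint B y))) (sqr_inner_le B).
  have := ler_wpM2r y2 (ler_dot2 _ _ _ _ _ _ (mulr_ge0 W1 x2) (mulr_ge0 W2 y2)
     (numerical_radius_abs_sqr _ _ x hA hB) (numerical_radius_abs_sqr _ _ y bA' bB')).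
  lra.
have cross : 2 * (rnorm '[A x, y] * rnorm '[B x, y]) <=
    w3 * rnorm x ^+ 2 * (w4 * rnorm y ^+ 2).
  have posA := abs_operator_pos _ hA; have posB := abs_operator_pos _ hB.
  have posA' := abs_operator_pos _ bA'; have posB' := abs_operator_pos _ bB'.
  have := numerical_radius_pair _ _ x posA posB.
  have := numerical_radius_pair _ _ y posA' posB'.
  have := mixed_Schwarz _ x y hA; have := mixed_Schwarz _ x y hB.
  have := pos_reinner_ge0 _ posA.2 x; have := pos_reinner_ge0 _ posB.2 x.
  have := pos_reinner_ge0 _ posA'.2 y; have := pos_reinner_ge0 _ posB'.2 y.
  rewrite -/w3 -/w4.
  move: (reinner (abs_operator (adjoint B) y) y) => q'.
  move: (reinner (abs_operator (adjoint A) y) y) => p'.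
  move: (reinner (abs_operator B x) x) (reinner (abs_operator A x) x) => q p.
  move=> q'0 p'0 q0 p0 ble ale le' le.
  rewrite -(ler_pXn2r (n := 2)) ?nnegrE ?mulr_ge0 ?rnorm_ge0 //.
  rewrite [leRHS]exprMn.
  apply: le_trans (ler_pM _ _ le le'); rewrite ?addr_ge0 ?sqr_ge0 //.
  apply: (@le_trans _ _ (2 * (p * q) * (2 * (p' * q')))).
    have := ler_pM (sqr_ge0 _) (sqr_ge0 _) ale ble; lra.
  have amgm (r s : R) : 2 * (r * s) <= r ^+ 2 + s ^+ 2.
    by have := sqr_ge0 (r - s); lra.
  by apply: ler_pM; rewrite ?mulr_ge0.
have uv : rnorm '[B (adjoint A y), y] <= w5 * rnorm y ^+ 2.
  exact: numerical_radius_ge (bounded_comp _ _ hB bA').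
have := sum_sqr_inner_le x (adjoint A y) (adjoint B y).
rewrite -!inner_adjoint // => /le_trans; apply.
have -> : W * (rnorm x ^+ 2 * rnorm y ^+ 2) ^+ 2 = rnorm x ^+ 2 *
    (w1 * rnorm x ^+ 2 * (w2 * rnorm y ^+ 2) * rnorm y ^+ 2 +
     w3 * rnorm x ^+ 2 * (w4 * rnorm y ^+ 2) * (w5 * rnorm y ^+ 2)).
  by rewrite /W; ring.
apply: ler_wpM2l => //; apply: lerD => //; apply: ler_pM => //.
  by rewrite !mulr_ge0 ?rnorm_ge0.
exact: rnorm_ge0.
Qed.

(** With [v] the image of [x], Cauchy-Schwarz in the two coefficients gives
    [|v|^4 <= |<A x, v>|^2 + |<B x, v>|^2], and the pointwise bound for the
    vectors [x] and [v] then reads [|v|^8 <= W |v|^4]. *)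
Lemma combination_le (l : R[i] * R[i]) x :
  rnorm l.1 ^+ 2 + rnorm l.2 ^+ 2 <= 1 -> rnorm x <= 1 ->
  rnorm ((l.1 \*: A \+ l.2 \*: B : H -> H) x) <= Num.sqrt (Num.sqrt W).
Proof.
move=> l1 x1; set v := (_ \+ _) x; set r := rnorm v.
have [W1 W2 W3 W4 W5] := w_ge0.
have W0 : 0 <= W by rewrite addr_ge0 ?mulr_ge0.
have r0 : 0 <= r by apply: rnorm_ge0.
set a := rnorm '[A x, v]; set b := rnorm '[B x, v].
have vle : r ^+ 2 <= rnorm l.1 * a + rnorm l.2 * b.
  rewrite -reinnerxx {1}/v /= reinnerDl; apply: lerD;
  by apply: le_trans (ler_Re_rnorm _) _; rewrite innerZl rnormcM.
have r4 : (r ^+ 2) ^+ 2 <= a ^+ 2 + b ^+ 2.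
  apply: le_trans (_ : (rnorm l.1 * a + rnorm l.2 * b) ^+ 2 <= _).
    by apply: lerXn2r => //; rewrite nnegrE ?sqr_ge0 // addr_ge0 ?mulr_ge0 ?rnorm_ge0.
  have := ler_wpM2r (addr_ge0 (sqr_ge0 a) (sqr_ge0 b)) l1.
  have := sqr_ge0 (rnorm l.1 * b - rnorm l.2 * a); lra.
have r8 : ((r ^+ 2) ^+ 2) ^+ 2 <= W * (r ^+ 2) ^+ 2.
  apply: le_trans (_ : (a ^+ 2 + b ^+ 2) ^+ 2 <= _).
    by apply: lerXn2r => //; rewrite nnegrE ?sqr_ge0 // addr_ge0 ?sqr_ge0.
  apply: le_trans (sum_sqr_inner_numerical_radius x v) _; apply: ler_wpM2l => //.
  have xr : rnorm x ^+ 2 * r ^+ 2 <= r ^+ 2.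
    by rewrite ler_piMl ?sqr_ge0 // expr_le1 // rnorm_ge0.
  by apply: lerXn2r xr; rewrite nnegrE ?sqr_ge0 // mulr_ge0 ?sqr_ge0.
have [r_eq0|rN0] := eqVneq r 0; first by rewrite r_eq0; exact: sqrtr_ge0.
have r2 : 0 < (r ^+ 2) ^+ 2 by rewrite !exprn_gt0 // lt0r rN0.
have r4W : (r ^+ 2) ^+ 2 <= W by move: r8; rewrite [leLHS]expr2 ler_pM2r.
rewrite -(ger0_norm r0) -sqrtr_sqr ler_wsqrtr //.
by rewrite -(ger0_norm (sqr_ge0 r)) -sqrtr_sqr ler_wsqrtr.
Qed.

Lemma euclidean_opnorm_le : euclidean_opnorm A B ^+ 2 <= Num.sqrt W.
Proof.
have opnorm_itv l : rnorm l.1 ^+ 2 + rnorm l.2 ^+ 2 <= 1 ->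
    0 <= opnorm (l.1 \*: A \+ l.2 \*: B) <= Num.sqrt (Num.sqrt W).
  move=> l1; set E := [set rnorm ((l.1 \*: A \+ l.2 \*: B) x) | x in [set x | rnorm x <= 1]]%classic.
  have E0 : E (rnorm ((l.1 \*: A \+ l.2 \*: B) 0)) by exists 0; rewrite //= rnorm0.
  have ubE : ubound E (Num.sqrt (Num.sqrt W)) by move=> _ [x x1 <-]; apply: combination_le.
  apply/andP; split; last by apply: ge_sup ubE; exists (rnorm ((l.1 \*: A \+ l.2 \*: B) 0)).
  apply: le_trans (rnorm_ge0 _) (ub_le_sup _ E0).
  by exists (Num.sqrt (Num.sqrt W)).
rewrite /euclidean_opnorm; set E := (X in sup X).
have ubE : ubound E (Num.sqrt (Num.sqrt W)).
  by move=> _ [l /opnorm_itv/andP[_ le] <-].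
have [r Er] : (E !=set0)%classic.
  exists (opnorm ((0 : R[i], 0 : R[i]).1 \*: A \+ (0 : R[i], 0 : R[i]).2 \*: B)), (0, 0) => //=.
  by rewrite rnorm0 expr0n addr0 ler01.
have r0 : 0 <= r by case: Er => l /opnorm_itv/andP[le _] <-.
have supE : sup E <= Num.sqrt (Num.sqrt W) by apply: ge_sup ubE; exists r.
have sup0 : 0 <= sup E by apply: le_trans r0 (ub_le_sup _ Er); exists (Num.sqrt (Num.sqrt W)).
rewrite -[leRHS]sqr_sqrtr ?sqrtr_ge0 //.
by apply: lerXn2r; rewrite ?nnegrE ?sqrtr_ge0.
Qed.

End EuclideanNorm.

Theorem theorem2p6 (R : realType) (H : hilbertType R) (A B : H -> H)
    (hA : bounded_operator A) (hB : bounded_operator B) :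
  euclidean_opnorm A B ^+ 2 <=
  Num.sqrt
    (numerical_radius
       ((abs_operator A \o abs_operator A) \+
        'i%C \*: (abs_operator B \o abs_operator B)) *
     numerical_radius
       ((abs_operator (adjoint A) \o abs_operator (adjoint A)) \+
        'i%C \*: (abs_operator (adjoint B) \o abs_operator (adjoint B))) +
     numerical_radius (abs_operator A \+ 'i%C \*: abs_operator B) *
     numerical_radius
       (abs_operator (adjoint A) \+ 'i%C \*: abs_operator (adjoint B)) *
     numerical_radius (B \o adjoint A)).
Proof. exact: euclidean_opnorm_le. Qed.
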